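(* There is no $3$-critical graph of even order less than $18$.
   Context: All graphs are finite and simple. The chromatic index $\chi'(G)$ is the least $k$ such that $G$ has a proper edge coloring with $k$ colors. A graph $G$ is $3$-critical if it is connected, has maximum degree $3$, satisfies $\chi'(G)=4$, and $\chi'(G-e)=3$ for every edge $e\in E(G)$. The order of a graph is its number of vertices. *)

(* Defs.v *)
From mathcomp Require Import all_boot.

Set Implicit Arguments.
Unset Strict Implicit.
Unset Printing Implicit Defensive.

Record sgraph := SGraph {
  vertex :> finType;
  adj : rel vertex;
  adj_sym : symmetric adj;
  adj_irrefl : irreflexive adj
}.

Definition edges (G : sgraph) : {set {set G}} :=
  [set [set p.1; p.2] | p : G * G & adj p.1 p.2].

Definition degree (G : sgraph) (x : G) : nat := #|[set y | adj x y]|.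

Definition max_degree (G : sgraph) : nat := \max_(x : G) degree x.

(* The empty graph counts as connected here; its maximum degree is 0, so it is
   excluded from [three_critical] anyway. *)
Definition connected (G : sgraph) : Prop :=
  forall x y : G, connect (@adj G) x y.

(* Colors are assigned to the subtype of actual edges, so that k = 0 is allowed
   exactly when the graph has no edge. *)
Definition proper_edge_coloring (G : sgraph) (k : nat)
    (c : {ffun {E : {set G} | E \in edges G} -> 'I_k}) : bool :=
  [forall E, forall F,
     (E != F) && (val E :&: val F != set0) ==> (c E != c F)].

Definition edge_colorable (G : sgraph) (k : nat) : bool :=
  [exists c : {ffun {E : {set G} | E \in edges G} -> 'I_k},
     proper_edge_coloring c].

Lemma ex_edge_colorable (G : sgraph) : exists k, edge_colorable G k.
Proof.
exists #|{: {E : {set G} | E \in edges G}}|.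
apply/existsP; exists [ffun E => enum_rank E].
apply/forallP => E; apply/forallP => F; apply/implyP => /andP[neqEF _].
by rewrite !ffunE (inj_eq enum_rank_inj).
Qed.

Definition chromatic_index (G : sgraph) : nat := ex_minn (ex_edge_colorable G).

Section DeleteEdge.

Variables (G : sgraph) (E : {set G}).

Definition del_adj : rel G := fun x y => adj x y && ([set x; y] != E).

Lemma del_adj_sym : symmetric del_adj.
Proof. by move=> x y; rewrite /del_adj adj_sym setUC. Qed.

Lemma del_adj_irrefl : irreflexive del_adj.
Proof. by move=> x; rewrite /del_adj adj_irrefl. Qed.

Definition del_edge : sgraph := SGraph del_adj_sym del_adj_irrefl.

End DeleteEdge.

Definition three_critical (G : sgraph) : Prop :=
  [/\ connected G,
      max_degree G = 3,
      chromatic_index G = 4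
    & forall E : {set G}, E \in edges G -> chromatic_index (del_edge E) = 3].

(* Main.v *)
Require Import Defs.
From mathcomp Require Import all_boot.

(* Let [D] be the set of vertices of degree 2 of a 3-critical graph [G] of even
   order.  A Kempe change shows that the closed neighborhoods of the vertices of
   [D] are pairwise disjoint, so [3 |D| <= |G| < 18] and [|D| <= 5].  Fix [d] in
   [D] with neighbors [a] and [b], and 3-color [G - da].  No color is free at
   both [d] and [a], so [d] misses two colors and [a] the third one.  Each color
   is missed by an even number of vertices, hence by an odd number of vertices
   of [D \ d]; thus [|D| = 4] and the other three vertices of [D] miss one color
   each.  This determines 12 vertices and 8 edges of [G]; at most 4 vertices, all
   of degree 3, remain.

   An exhaustive search reveals one unknown colored edge after the other.  A
   partial graph is abandoned when its known edges together with [da] can be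
   recolored without touching the colors of the unknown edges, because then [G]
   would be 3-colorable.  Every complete graph that survives has an edge whose
   deletion does not make it 3-colorable, so it is not critical. *)

Set Implicit Arguments.
Unset Strict Implicit.
Unset Printing Implicit Defensive.

(** * The search program *)

(* Row [v] of a table records, for each color [c < 3], what is known of the edge
   of color [c] at the vertex number [v]: not yet revealed, absent, or leading to
   the vertex number [w]. *)
Inductive slot := Unk | Mis | To of nat.

Record row := Row { r0 : slot; r1 : slot; r2 : slot }.

Definition urow := Row Unk Unk Unk.

Definition rget r c := match c with 0 => r0 r | 1 => r1 r | _ => r2 r end.

Definition rset c s r :=
  let: Row a b e := r in
  match c with 0 => Row s b e | 1 => Row a s e | _ => Row a b s end.

Definition get T v c := rget (nth urow T v) c.

Fixpoint upd (A : Type) (f : A -> A) (T : seq A) (v : nat) : seq A :=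
  match T with
  | [::] => [::]
  | x :: T' => match v with 0 => f x :: T' | v'.+1 => x :: upd f T' v' end
  end.

Definition join T v c w := upd (rset c (To w)) (upd (rset c (To v)) T w) v.

Record mask := Mask { m0 : bool; m1 : bool; m2 : bool }.

Definition nomask := Mask false false false.
Definition fullmask := Mask true true true.

Definition mget m c := match c with 0 => m0 m | 1 => m1 m | _ => m2 m end.

Definition mset c b m :=
  let: Mask x y z := m in
  match c with 0 => Mask b y z | 1 => Mask x b z | _ => Mask x y b end.

Definition upd2 c b (M : seq mask) u v := upd (mset c b) (upd (mset c b) M u) v.

Notation edge := (nat * nat * nat)%type.

(* Tries to color the edges [es] one after the other, where [M] lists the colors
   still available at each vertex. *)
Fixpoint ext (M : seq mask) (es : seq edge) : bool :=
  match es with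
  | [::] => true
  | (u, v, _) :: es' =>
    let: Mask a b c := nth nomask M u in
    let: Mask a' b' c' := nth nomask M v in
    if (if a then if a' then ext (upd2 0 false M u v) es' else false else false)
    then true else
    if (if b then if b' then ext (upd2 1 false M u v) es' else false else false)
    then true else
    if c then if c' then ext (upd2 2 false M u v) es' else false else false
  end.

(* [bfs], [chain] and [pick_slot] only guide the search; their output is checked
   where it is used, so nothing needs to be proved about them. *)
Fixpoint bfs fuel T (q : seq nat) (seen done : seq bool) : seq edge :=
  match fuel, q with
  | fuel'.+1, v :: q' =>
    let done' := upd (fun _ => true) done v in
    (fix go (cs : seq nat) seen q acc :=
       match cs with
       | [::] => cat acc (bfs fuel' T q seen done')
       | c :: cs' =>
         match get T v c with
         | To w =>
           if nth true done w then go cs' seen q acc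
           else if nth true seen w then go cs' seen q (rcons acc (v, w, c))
           else go cs' (upd (fun _ => true) seen w) (rcons q w)
                   (rcons acc (v, w, c))
         | _ => go cs' seen q acc
         end
       end) [:: 0; 1; 2] seen q' [::]
  | _, _ => [::]
  end.

Definition comp T : seq edge :=
  let s := nseq (size T) false in
  bfs (size T) T [:: 1] (upd (fun _ => true) s 1) s.

Definition isMis s := if s is Mis then true else false.
Definition isUnk s := if s is Unk then true else false.
Definition isTo s w := if s is To w' then eqn w w' else false.

Definition known T (e : edge) := let: (u, v, c) := e in (c < 3) && isTo (get T u c) v.

Definition masks0 (T : seq row) :=
  [seq Mask (isMis (r0 r)) (isMis (r1 r)) (isMis (r2 r)) | r <- T].

(* A color becomes available for recoloring only if it is absent at the vertex or
   belongs to an edge of [es], which is going to be recolored; in particular the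
   colors of unrevealed edges stay blocked. *)
Fixpoint masks (M : seq mask) (es : seq edge) :=
  if es is (u, v, c) :: es' then masks (upd2 c true M u v) es' else M.

(* The vertices 0 and 1 are [d] and [a]; the edge between them has no color yet,
   which is encoded by the color 3. *)
Definition recolorable T :=
  let es := comp T in
  all (known T) es && ext (masks (masks0 T) es) ((0, 1, 3) :: es).

Definition same_edge (e f : edge) :=
  let: (a, b, _) := e in let: (c, d, _) := f in
  (eqn a c && eqn b d) || (eqn a d && eqn b c).

(** Refutes criticality: once some revealed edge is removed, the known edges around [a], together
    with [da], admit no 3-coloring from scratch, hence the full masks. Distinctness of the listed
    edges prevents one edge from being colored twice. *)
Definition noncritical T :=
  let es := (0, 1, 3) :: comp T in
  let M := nseq (size T) fullmask in
  [&& all (known T) (comp T),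
      pairwise (fun e f => ~~ same_edge e f) es &
      has (fun v => has (fun c => if get T v c is To w then
             ~~ ext M [seq f <- es | ~~ same_edge (v, w, c) f] else false)
        [:: 0; 1; 2]) (rev (iota 0 (size T)))].

Fixpoint chain fuel T v c c' : option (nat * nat) :=
  if fuel is fuel'.+1 then
    match get T v c with
    | Unk => Some (v, c)
    | Mis => None
    | To w => chain fuel' T w c' c
    end
  else None.

Definition unks r := [seq c <- [:: 0; 1; 2] | isUnk (rget r c)].

Fixpoint first_unk k i T : option (nat * nat) :=
  if T is r :: T' then
    let s := unks r in
    if eqn (size s) k then Some (i, head 0 s) else first_unk k i.+1 T'
  else None.

(** Row 1 is [a], which misses color 2, while [d] misses 0 and 1. A chain from [a] in colors 0, 2 or
    1, 2 that did not end at [d] could be swapped to give a 3-coloring, so these two chains are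
    revealed first. *)
Definition pick_slot T :=
  if chain 20 T 1 0 2 is Some q then Some q else
  if chain 20 T 1 1 2 is Some q then Some q else
  if first_unk 1 0 T is Some q then Some q else
  first_unk 2 0 T.

Definition cand T v c w :=
  if isUnk (get T w c)
  then ~~ (eqn v w || has (fun c' => isTo (get T v c') w) [:: 0; 1; 2])
  else false.

(** The other end of the chosen edge is a row with that slot open or an unnumbered vertex;
    unnumbered vertices look alike, so one fresh row stands for all of them. Exhausted fuel gives
    [false], so [true] certifies a finished search. *)
Fixpoint search fuel N T :=
  if fuel is fuel'.+1 then
    let try T' := if recolorable T' then true else search fuel' N T' in
    match pick_slot T with
    | None => noncritical T
    | Some (v, c) =>
      [&& v < size T, c < 3, isUnk (get T v c),
          all (fun w => if cand T v c w then try (join T v c w) else true)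
              (iota 0 (size T)) &
          if size T < N then try (join (rcons T urow) v c (size T)) else true]
    end
  else false.

(* In the order of the rows: [d; a; b], then each further vertex of degree 2
   followed by its two neighbors. *)
Definition T0 : seq row :=
  [:: Row Mis Mis (To 2); Row Unk Unk Mis; Row Unk Unk (To 0);
      Row Mis (To 4) (To 5); Row Unk (To 3) Unk; Row Unk Unk (To 3);
      Row (To 7) Mis (To 8); Row (To 6) Unk Unk; Row Unk Unk (To 6);
      Row (To 10) (To 11) Mis; Row (To 9) Unk Unk; Row Unk (To 9) Unk].


Lemma color_ind (P : nat -> Prop) : P 0 -> P 1 -> P 2 -> forall c, c < 3 -> P c.
Proof. by move=> ? ? ? [|[|[|]]]. Qed.

(** * Partial colorings *)

Section PartialColorings.

Variable G : sgraph.
Implicit Types (x y z u v : G) (k : G -> G -> nat) (c : nat).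

(* An edge [x y] with [3 <= k x y] is uncolored. *)
Definition pcoloring k :=
  (forall x y, k x y = k y x) /\
  (forall x y z, adj x y -> adj x z -> k x y < 3 -> k x y = k x z -> y = z).

Definition free k x c := forall y, adj x y -> k x y <> c.

Definition same_pair x y u v := ((x == u) && (y == v)) || ((x == v) && (y == u)).

Definition recolor k u v c : G -> G -> nat :=
  fun x y => if same_pair x y u v then c else k x y.

Lemma adj_neq x y : adj x y -> x != y.
Proof. by apply: contraTneq => ->; rewrite adj_irrefl. Qed.

Lemma same_pairC x y u v : same_pair x y u v = same_pair y x u v.
Proof. by rewrite /same_pair; do 4!case: (_ == _). Qed.

(** For [c = 3] the condition is void: an edge may always be uncolored. *)
Lemma pcoloring_recolor k u v c : pcoloring k ->
  (c < 3 -> free k u c /\ free k v c) -> pcoloring (recolor k u v c).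
Proof.
move=> [symk prk] frk; split=> [x y|x y z xy xz].
  by rewrite /recolor same_pairC symk.
rewrite /recolor; case: ifP => [exy|_].
  move=> c3; have [fu fv] := frk c3.
  case: ifP => [exz _|_ e].
    case/orP: exy exz (adj_neq xy) (adj_neq xz) => /andP[/eqP-> /eqP->];
      case/orP=> /andP[/eqP e1 /eqP e2]; rewrite ?e1 ?e2 ?eqxx //.
  by case/orP: exy => /andP[/eqP ? _]; subst x; [case: (fu z xz)|case: (fv z xz)].
case: ifP => [exz kc e|_]; last exact: prk.
rewrite e in kc; have [fu fv] := frk kc.
by case/orP: exz => /andP[/eqP ? _]; subst x; [case: (fu y xy)|case: (fv y xy)].
Qed.

(** Passes from functions on pairs of vertices to colorings of edges as sets, reading each edge
    through a chosen pair of endpoints. *)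
Lemma pcoloring_total k : pcoloring k ->
  (forall x y, adj x y -> k x y < 3) -> edge_colorable G 3.
Proof.
move=> [symk prk] tot.
have rep (E : {E : {set G} | E \in edges G}) :
    exists p : G * G, adj p.1 p.2 && (val E == [set p.1; p.2]).
  case: E => E /= /imsetP[p]; rewrite inE => pa ->.
  by exists p; rewrite pa eqxx.
pose f E := k (xchoose (rep E)).1 (xchoose (rep E)).2.
apply/existsP; exists [ffun E => inord (f E)].
apply/forallP => E; apply/forallP => F; apply/implyP => /andP[EF].
rewrite !ffunE /f; have /andP[] := xchooseP (rep E); have /andP[] := xchooseP (rep F).
move: (xchoose (rep E)) (xchoose (rep F)) => [x y] [x' y'] /= a' /eqP eF a /eqP eE.
rewrite -val_eqE in EF; rewrite /= eE eF in EF *.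
case/set0Pn => z; rewrite !inE => /andP[zE zF].
apply/eqP => /(congr1 val) /=; rewrite !inordK ?tot // => e.
have [p [ap kp pE]] : exists p, [/\ adj z p, k z p = k x y & [set x; y] = [set z; p]].
  case/orP: zE => /eqP->; first by exists y.
  by exists x; rewrite adj_sym symk setUC.
have [q [aq kq qE]] : exists q, [/\ adj z q, k z q = k x' y' & [set x'; y'] = [set z; q]].
  case/orP: zF => /eqP->; first by exists y'.
  by exists x'; rewrite adj_sym symk setUC.
by case/eqP: EF; rewrite pE qE (prk z p q) ?kp ?kq ?tot.
Qed.

End PartialColorings.

(** * Soundness of the search *)

Lemma size_upd (A : Type) (f : A -> A) T v : size (upd f T v) = size T.
Proof. by elim: T v => [|x T IH] [|v] //=; rewrite IH. Qed.

Lemma nth_upd (A : Type) x0 (f : A -> A) T v i : v < size T ->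
  nth x0 (upd f T v) i = if i == v then f (nth x0 T v) else nth x0 T i.
Proof. by elim: T v i => [|x T IH] [|v] [|i] //= vT; rewrite IH. Qed.

Lemma mget_mset c b m c' : c < 3 -> c' < 3 ->
  mget (mset c b m) c' = if c' == c then b else mget m c'.
Proof. by case: m => ? ? ?; move: c; apply: color_ind; move: c'; apply: color_ind. Qed.

Lemma rget_rset c s r c' : c < 3 -> c' < 3 ->
  rget (rset c s r) c' = if c' == c then s else rget r c'.
Proof. by case: r => ? ? ?; move: c; apply: color_ind; move: c'; apply: color_ind. Qed.

Lemma mget_upd2 c b M u v i c' : c < 3 -> c' < 3 -> u < size M -> v < size M ->
  mget (nth nomask (upd2 c b M u v) i) c' =
  if ((i == u) || (i == v)) && (c' == c) then b else mget (nth nomask M i) c'.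
Proof.
move=> c3 c'3 uM vM; rewrite /upd2 nth_upd ?size_upd // !nth_upd //.
have [->|_] := eqVneq i v; rewrite ?orbT ?orbF; last first.
  by case: eqP => [->|//]; rewrite mget_mset.
rewrite mget_mset // /=; case: (eqVneq c' c) => //= cc'.
by case: eqP => [->|//]; rewrite mget_mset // (negbTE cc').
Qed.

Section Search.

Variables (G : sgraph) (N : nat) (x0 : G) (k0 : G -> G -> nat).
Hypothesis cardG : #|G| <= N.
Hypothesis not_colorable : ~ edge_colorable G 3.
Hypothesis critical : forall x y : G, adj x y ->
  exists2 k : G -> G -> nat, pcoloring k &
    forall u v, adj u v -> ~~ same_pair u v x y -> k u v < 3.
Hypothesis pk0 : pcoloring k0.

Implicit Types (T : seq row) (lab : seq G) (M : seq mask) (es : seq edge).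

Definition sees (k : G -> G -> nat) x c := exists2 y, adj x y & k x y = c.

Definition slot_ok T lab i c :=
  match get T i c with
  | Unk => sees k0 (nth x0 lab i) c
  | Mis => free k0 (nth x0 lab i) c
  | To j => [/\ j < size T, adj (nth x0 lab i) (nth x0 lab j),
               k0 (nth x0 lab i) (nth x0 lab j) = c & get T j c = To i]
  end.

(** This makes [urow] the correct row for every vertex met later. *)
Definition full lab := forall y, y \notin lab -> forall c, c < 3 -> sees k0 y c.

Definition represents T lab :=
  [/\ size lab = size T, uniq lab, full lab &
      forall i c, i < size T -> c < 3 -> slot_ok T lab i c].

Definition edge_ok lab (e : edge) :=
  let: (u, v, c) := e in
  [/\ u < size lab, v < size lab, adj (nth x0 lab u) (nth x0 lab v) &
      k0 (nth x0 lab u) (nth x0 lab v) = c].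

Definition joins lab (e : edge) x y :=
  let: (u, v, _) := e in same_pair x y (nth x0 lab u) (nth x0 lab v).

Definition masks_ok lab M (k : G -> G -> nat) := 
  size M = size lab /\
  forall i c, i < size lab -> c < 3 -> mget (nth nomask M i) c -> free k (nth x0 lab i) c.

Lemma size_upd2 c b M u v : size (upd2 c b M u v) = size M.
Proof. by rewrite !size_upd. Qed.

(** Each choice made by [ext] is copied into [k]. Throughout, the masks allow only free colors and
    every uncolored edge is still in the list; at the end of the list none is left. *)
Lemma ext_sound lab es : uniq lab -> {in es, forall e, edge_ok lab e} ->
  forall M k, masks_ok lab M k -> pcoloring k ->
  (forall x y, adj x y -> 2 < k x y -> exists2 e, e \in es & joins lab e x y) ->
  ext M es -> edge_colorable G 3.
Proof.
move=> ulab; elim: es => [|[[u v] c] es IH] es_ok M k [sM Mk] pk unc.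
  move=> _; apply: (pcoloring_total pk) => x y xy.
  by rewrite ltnNge; apply/negP => /(unc _ _ xy) [e].
have [uL vL uv _] : edge_ok lab (u, v, c) by apply: es_ok; rewrite mem_head.
have es_ok' : {in es, forall e, edge_ok lab e}.
  by move=> e e_es; apply: es_ok; rewrite inE e_es orbT.
have step d : d < 3 -> mget (nth nomask M u) d -> mget (nth nomask M v) d ->
    ext (upd2 d false M u v) es -> edge_colorable G 3.
  move=> d3 Mu Mv; apply: (IH es_ok' _ (recolor k (nth x0 lab u) (nth x0 lab v) d)).
  - split=> [|i c' iL c'3]; first by rewrite size_upd2.
    rewrite mget_upd2 ?sM //; case: ifP => // iuv Mi y iy.
    rewrite /recolor; case: ifP => [/orP e ed|_]; last exact: Mk iL c'3 Mi y iy.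
    case/negP: (negbT iuv); rewrite ed eqxx andbT.
    by case: e => /andP[e _]; rewrite nth_uniq in e; rewrite // e ?orbT.
  - by apply: pcoloring_recolor => // _; split; apply: Mk.
  - move=> x y xy; rewrite /recolor; case: ifP => [_|nuv kxy]; first by rewrite ltnNge -ltnS d3.
    have [e] := unc x y xy kxy; rewrite inE => /orP[/eqP->|e_es je]; last by exists e.
    by rewrite /= nuv.
rewrite /=; case Eu: (nth nomask M u) => [a b d]; case Ev: (nth nomask M v) => [a' b' d'].
move: (step 0) (step 1) (step 2); rewrite Eu Ev /= {step Eu Ev}.
move: (ext _ _) (ext _ _) (ext _ _) => C B A.
case: a; case: a'; case: A => //= h0 h1 h2; try by move=> _; apply: h0.
all: case: b h1; case: b'; case: B => //= h1; try by move=> _; apply: h1.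
all: case: d h2; case: d'; case: C => //= h2; by move=> _; apply: h2.
Qed.

Lemma same_pair_nth lab i j i' j' : uniq lab -> i < size lab -> j < size lab ->
  i' < size lab -> j' < size lab ->
  same_pair (nth x0 lab i) (nth x0 lab j) (nth x0 lab i') (nth x0 lab j') =
  (eqn i' i && eqn j' j) || (eqn i' j && eqn j' i).
Proof. by move=> *; rewrite /same_pair !nth_uniq // !eqnE ![_ == i]eq_sym ![_ == j]eq_sym [X in _ || X]andbC. Qed.

(** The search can follow [k]: the color of each remaining edge under [k] stays available at both of
    its ends. *)
Lemma ext_complete lab k es : uniq lab -> pcoloring k ->
  {in es, forall e, let: (u, v, _) := e in
     [/\ u < size lab, v < size lab, adj (nth x0 lab u) (nth x0 lab v) &
         k (nth x0 lab u) (nth x0 lab v) < 3]} ->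
  pairwise (fun e f => ~~ same_edge e f) es ->
  forall M, size M = size lab ->
  {in es, forall e, let: (u, v, _) := e in
     let c := k (nth x0 lab u) (nth x0 lab v) in
     mget (nth nomask M u) c && mget (nth nomask M v) c} ->
  ext M es.
Proof.
move=> ulab [symk prk]; elim: es => [|[[u v] c0] es IH] //= es_ok /andP[/allP ne pw] M sM Mok.
have [uL vL uv] := es_ok _ (mem_head _ _).
set c := k _ _ => c3.
have /andP[Mu Mv] := Mok _ (mem_head _ _); rewrite -/c in Mu Mv.
have {IH} : ext (upd2 c false M u v) es.
  apply: IH => //.
  - by move=> e e_es; apply: es_ok; rewrite inE e_es orbT.
  - by rewrite size_upd2.
  move=> [[u' v'] c'] e_es.
  have e_es1 : (u', v', c') \in (u, v, c0) :: es by rewrite inE e_es orbT.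
  have [u'L v'L uv' c'3] := es_ok _ e_es1.
  have /andP[Mu' Mv'] := Mok _ e_es1.
  have := ne _ e_es; rewrite /= => nse.
  rewrite !mget_upd2 ?sM // Mu' Mv'.
  set d := k _ _ in c'3 Mu' Mv' *.
  have [dc|] := eqVneq d c; last by rewrite !andbF.
  rewrite !andbT.
  have sh x y z t : adj x y -> adj z t -> k x y = c -> k z t = c -> x = z -> y = t.
    move=> xy zt e1 e2 xz; subst z; apply: (prk x y t) => //; first by rewrite e1.
    by rewrite e1.
  have vu : adj (nth x0 lab v) (nth x0 lab u) by rewrite adj_sym.
  have vu' : adj (nth x0 lab v') (nth x0 lab u') by rewrite adj_sym.
  have kvu : k (nth x0 lab v) (nth x0 lab u) = c by rewrite symk.
  have kvu' : k (nth x0 lab v') (nth x0 lab u') = c by rewrite symk.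
  have inj a b : a < size lab -> b < size lab -> nth x0 lab a = nth x0 lab b -> a = b.
    by move=> aL bL /eqP; rewrite nth_uniq // => /eqP.
  (* Two edges of equal color with a common end would coincide, contrary to [nse]; so the color just
     used is not blocked for the later edge. *)
  have no : (u' == u) || (u' == v) || (v' == u) || (v' == v) = false.
    apply: contraNF nse; rewrite !eqnE.
    case/orP=> [/orP[/orP[]|]|] /eqP e; subst.
    - by rewrite eqxx (inj v v' vL v'L) ?eqxx //; apply: sh uv uv' _ _ _.
    - by rewrite eqxx (inj u v' uL v'L) ?eqxx ?orbT //; apply: sh vu uv' _ _ _.
    - by rewrite eqxx (inj v u' vL u'L) ?eqxx ?orbT //; apply: sh uv vu' _ _ _.
    - by rewrite eqxx (inj u u' uL u'L) ?eqxx //; apply: sh vu vu' _ _ _.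
  by case: (u' == u) no; case: (u' == v); case: (v' == u); case: (v' == v).
case: (nth nomask M u) Mu => [a b d]; case: (nth nomask M v) Mv => [a' b' d'].
by move: (c) c3; apply: color_ind => /= -> -> -> /=; rewrite ?if_same.
Qed.

Lemma known_edge_ok T lab e : represents T lab -> known T e -> edge_ok lab e.
Proof.
case: e => [[u v] c] [sL uL _ ok] /andP[c3] /=.
have [uT|Tu] := ltnP u (size T); last by rewrite /get nth_default //; case: c c3 => [|[|]].
have := ok u c uT c3; rewrite /slot_ok; case: (get T u c) => //= j [jT ? ? _].
by rewrite eqnE => /eqP ->; rewrite sL.
Qed.

(** The listed edges are uncolored one after the other; each frees its old color at both ends, as
    [masks] records. *)
Lemma masks_sound lab es : uniq lab ->
  {in es, forall e : edge, edge_ok lab e /\ e.2 < 3} ->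
  forall M k, masks_ok lab M k -> pcoloring k ->
  (forall x y, adj x y -> k x y < 3 -> k x y = k0 x y) ->
  exists k', [/\ masks_ok lab (masks M es) k', pcoloring k' &
    forall x y, adj x y -> 2 < k' x y ->
      2 < k x y \/ exists2 e, e \in es & joins lab e x y].
Proof.
move=> ulab; elim: es => [|[[u v] c] es IH] es_ok M k Mk pk sub.
  by exists k; split=> // x y _; left.
have [[uL vL uv kuv] c3] := es_ok _ (mem_head _ _); rewrite /= in c3 kuv.
have es_ok' : {in es, forall e : edge, edge_ok lab e /\ e.2 < 3}.
  by move=> e e_es; apply: es_ok; rewrite inE e_es orbT.
have [symk0 prk0] := pk0; have [sM Mf] := Mk.
pose k1 := recolor k (nth x0 lab u) (nth x0 lab v) 3.
(* Colors surviving in [k] agree with [k0], where no second edge of color [c] meets [x]. *)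
have fr x y : adj x y -> k0 x y = c -> same_pair x y (nth x0 lab u) (nth x0 lab v) ->
    free k1 x c.
  move=> xy kc exy z xz; rewrite /k1 /recolor; case: ifP => [_ e|nxz e]; first by rewrite -e in c3.
  have := sub x z xz; rewrite e => /(_ c3) ec.
  by rewrite -(prk0 x y z xy xz) ?kc // exy in nxz.
have [|||k' [Mk' pk' unc]] := IH es_ok' (upd2 c true M u v) k1.
- split=> [|i c' iL c'3]; first by rewrite size_upd2.
  rewrite mget_upd2 ?sM //; case: ifP => [/andP[/orP[]/eqP-> /eqP->] _|_ /(Mf i c' iL c'3) Mi].
  + by apply: fr uv kuv _; rewrite /same_pair !eqxx.
  + by apply: fr (nth x0 lab u) _ _ _; rewrite 1?adj_sym // 1?symk0 // /same_pair !eqxx orbT.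
  + by move=> y iy; rewrite /k1 /recolor; case: ifP => [_ e|_]; [rewrite -e in c'3 | apply: Mi].
- by apply: pcoloring_recolor.
- by move=> x y xy; rewrite /k1 /recolor; case: ifP => // _; apply: sub.
exists k'; split=> // x y xy /(unc x y xy) [|[e e_es je]]; last first.
  by right; exists e => //; rewrite inE e_es orbT.
rewrite /k1 /recolor; case: ifP => [je _|_]; last by left.
by right; exists (u, v, c); first exact: mem_head.
Qed.

(** Uncoloring the edges of [comp T] and recoloring them together with [da] by [ext] would 3-color
    [G]. *)
Lemma recolorable_sound T lab : represents T lab ->
  1 < size T -> adj (nth x0 lab 0) (nth x0 lab 1) -> k0 (nth x0 lab 0) (nth x0 lab 1) = 3 ->
  (forall x y, adj x y -> 2 < k0 x y -> same_pair x y (nth x0 lab 0) (nth x0 lab 1)) ->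
  ~~ recolorable T.
Proof.
move=> rep T2 a01 k01 only; apply/negP => /andP[/allP kn].
have [sL ulab fl ok] := rep.
have es_ok : {in comp T, forall e : edge, edge_ok lab e /\ e.2 < 3}.
  move=> e /kn ke; split; first exact: known_edge_ok ke.
  by case: e ke => [[? ?] ?] /andP[].
have M0 : masks_ok lab (masks0 T) k0.
  split=> [|i c iL c3]; first by rewrite size_map.
  rewrite (nth_map urow) -?sL //; have := ok i c; rewrite -sL => /(_ iL c3).
  rewrite /slot_ok /get; move: c c3; apply: color_ind; case: (nth urow T i) => [[||?] [||?] [||?]] //=.
have [k [Mk pk unc]] := masks_sound ulab es_ok M0 pk0 (fun _ _ _ _ => erefl).
move=> ex; apply: not_colorable; apply: ext_sound Mk pk _ ex => //.
  move=> e; rewrite inE => /orP[/eqP->|/es_ok[]//]; rewrite /= sL; split=> //.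
  exact: ltnW.
move=> x y xy /(unc x y xy) [/(only x y xy) je|[e e_es je]].
  by exists (0, 1, 3); first exact: mem_head.
by exists e => //; rewrite inE e_es orbT.
Qed.

(** Criticality 3-colors [G] without the removed edge; by [ext_complete], [ext] would then have
    succeeded. *)
Lemma noncritical_sound T lab : represents T lab ->
  1 < size T -> adj (nth x0 lab 0) (nth x0 lab 1) -> k0 (nth x0 lab 0) (nth x0 lab 1) = 3 ->
  ~~ noncritical T.
Proof.
move=> rep T2 a01 k01; apply/negP => /and3P[/allP kn pw].
case/hasP=> v _ /hasP[c]; case Ec: (get T v c) => [||w] // cs nex.
have c3 : c < 3 by move: cs; rewrite !inE; case/or3P=> /eqP->.
have [sL ulab fl ok] := rep.
have [vL wL vw _] : edge_ok lab (v, w, c).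
  by apply: known_edge_ok rep _; rewrite /= c3 Ec /= eqnE eqxx.
have [k pk kall] := critical vw.
set es := _ :: _ in pw nex; case/negP: nex; apply: (ext_complete ulab pk).
- move=> [[u' v'] c']; rewrite mem_filter => /andP[ns].
  rewrite inE => e_es.
  have [u'L v'L uv' _] : edge_ok lab (u', v', c').
    case/orP: e_es => [/eqP[-> -> ->]|/kn]; last exact: known_edge_ok.
    by rewrite /= sL; split=> //; apply: ltnW.
  split=> //; apply: kall => //.
  by rewrite same_pair_nth.
- exact: pairwise_filter.
- by rewrite size_nseq.
- move=> [[u' v'] c']; rewrite mem_filter => /andP[_].
  rewrite inE => e_es.
  have [u'L v'L uv' _] : edge_ok lab (u', v', c').
    case/orP: e_es => [/eqP[-> -> ->]|/kn]; last exact: known_edge_ok.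
    by rewrite /= sL; split=> //; apply: ltnW.
  by rewrite /= !nth_nseq -sL u'L v'L /=; case: (k _ _) => [|[|?]].
Qed.

Lemma get_join T v c w i c' : c < 3 -> c' < 3 -> v < size T -> w < size T -> v != w ->
  get (join T v c w) i c' =
  if (i == v) && (c' == c) then To w else
  if (i == w) && (c' == c) then To v else get T i c'.
Proof.
move=> c3 c'3 vT wT vw; rewrite /get /join nth_upd ?size_upd // !nth_upd //.
have [->|iv] := eqVneq i v; first by rewrite (negbTE vw) rget_rset.
by have [->|iw] := eqVneq i w; rewrite ?rget_rset.
Qed.

Lemma represents_join T lab v c w : represents T lab -> c < 3 ->
  v < size T -> w < size T -> v != w -> get T v c = Unk -> get T w c = Unk ->
  adj (nth x0 lab v) (nth x0 lab w) -> k0 (nth x0 lab v) (nth x0 lab w) = c ->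
  represents (join T v c w) lab.
Proof.
move=> [sL ulab fl ok] c3 vT wT vw Tv Tw avw kvw; split=> //.
  by rewrite /join !size_upd.
have wv : w != v by rewrite eq_sym.
move=> i c'; rewrite {1}/join !size_upd => iT c'3.
have := ok i c' iT c'3; rewrite /slot_ok /join !size_upd -/(join T v c w) !get_join //.
case: ifP => [/andP[/eqP-> /eqP->] _|niv].
  by rewrite get_join // (negbTE wv) !eqxx.
case: ifP => [/andP[/eqP-> /eqP->] _|niw].
  by rewrite get_join // !eqxx adj_sym (pk0.1 (nth x0 lab w)).
case Ei: (get T i c') => [||j] // [jT aij kij Ej]; split=> //.
(* The slot at [j] that points back is not overwritten, since both overwritten slots were
   unrevealed. *)
rewrite get_join //; case: ifP => [/andP[/eqP jv /eqP cc]|_].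
  by rewrite jv cc Tv in Ej.
by case: ifP => [/andP[/eqP jv /eqP cc]|_] //; rewrite jv cc Tw in Ej.
Qed.

Lemma represents_rcons T lab y : represents T lab -> y \notin lab ->
  represents (rcons T urow) (rcons lab y).
Proof.
move=> [sL ulab fl ok] ylab; split; first by rewrite !size_rcons sL.
- by rewrite rcons_uniq ylab.
- by move=> z; rewrite mem_rcons inE negb_or => /andP[_ zlab]; apply: fl.
move=> i c; rewrite size_rcons ltnS => iT c3.
rewrite /slot_ok /get !nth_rcons sL; move: iT; rewrite leq_eqVlt => /orP[/eqP->|iT].
  rewrite ltnn eqxx; case Eu: (rget urow c) => [||j]; first exact: fl.
    by case: c c3 Eu => [|[|[]]].
  by case: c c3 Eu => [|[|[]]].
rewrite iT; have := ok i c iT c3; rewrite /slot_ok /get.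
case: (rget _ c) => [||j] // [jT aij kij Ej].
by rewrite size_rcons !nth_rcons sL jT; split=> //; apply: ltnW.
Qed.

(** The true graph always survives: among the branches is the one that names the actual neighbor of
    [v] along color [c], and there the new table again represents [G]. *)
Lemma search_sound (a : G) fuel T lab : represents T lab ->
  1 < size T -> take 2 lab = [:: x0; a] -> adj x0 a -> k0 x0 a = 3 ->
  (forall x y, adj x y -> 2 < k0 x y -> same_pair x y x0 a) ->
  ~~ search fuel N T.
Proof.
move=> rep T2 lab2 ax ka only; elim: fuel T lab rep T2 lab2 => //= fuel IH T lab rep T2 lab2.
have start T' lab' : 1 < size T' -> take 2 lab' = [:: x0; a] ->
    [/\ adj (nth x0 lab' 0) (nth x0 lab' 1), k0 (nth x0 lab' 0) (nth x0 lab' 1) = 3 &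
     forall x y, adj x y -> 2 < k0 x y -> same_pair x y (nth x0 lab' 0) (nth x0 lab' 1)].
  by case: lab' => [|? [|? ?]] //= _ [-> ->].
case: (pick_slot T) => [[v c]|]; last first.
  by have [] := start T lab T2 lab2; move=> ? ? _; apply: noncritical_sound rep _ _ _.
apply/negP => /and5P[vT c3 /=]; case Tv: (get T v c) => // _ /allP old new.
have tryP T' lab' : represents T' lab' -> 1 < size T' -> take 2 lab' = [:: x0; a] ->
    (if recolorable T' then true else search fuel N T') = false.
  move=> rep' T'2 lab'2; have [? ? ?] := start T' lab' T'2 lab'2.
  rewrite (negbTE (recolorable_sound rep' _ _ _ _)) //.
  by apply/negbTE; apply: IH rep' _ _.
have [sL ulab fl ok] := rep; have [symk prk] := pk0.
have := ok v c vT c3; rewrite /slot_ok Tv => -[y vy kvy].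
have [ylab|ylab] := boolP (y \in lab); last first.
  have TN : size T < N.
    apply: leq_trans cardG; rewrite -sL.
    have := uniq_leq_size (s1 := rcons lab y) (s2 := enum G).
    rewrite size_rcons -cardE; apply; first by rewrite rcons_uniq ylab.
    by move=> z _; rewrite mem_enum.
  have rep1 := represents_rcons rep ylab.
  move: new; rewrite TN (tryP _ (rcons lab y)) //.
  - apply: (represents_join rep1 c3); rewrite ?size_rcons //.
    + exact: ltnW.
    + by rewrite neq_ltn vT.
    + by rewrite /get nth_rcons vT.
    + by rewrite /get nth_rcons ltnn eqxx; case: (c) c3 => [|[|[]]].
    + by rewrite !nth_rcons sL vT ltnn eqxx.
    + by rewrite !nth_rcons sL vT ltnn eqxx.
  - by rewrite /join !size_upd size_rcons; apply: ltnW.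
  - by rewrite -cats1 takel_cat // sL.
pose w := index y lab.
have wT : w < size T by rewrite -sL index_mem.
have Lw : nth x0 lab w = y by rewrite nth_index.
have inj i j : i < size T -> j < size T -> nth x0 lab i = nth x0 lab j -> i = j.
  by rewrite -sL => iL jL /eqP; rewrite nth_uniq // => /eqP.
have vw : v != w.
  by apply: contraTneq vy => vw; rewrite -Lw -vw adj_irrefl.
(* The edge from [v] excludes [Mis]; an entry [To j] would force [j = v], whose slot is
   unrevealed. *)
have Tw : get T w c = Unk.
  have := ok w c wT c3; rewrite /slot_ok Lw; case Ew: (get T w c) => [||j] //.
    by move=> /(_ (nth x0 lab v)); rewrite adj_sym symk => /(_ vy).
  case=> jT wj kwj Ej.
  have yv : adj y (nth x0 lab v) by rewrite adj_sym.
  have := inj j v jT vT (prk _ _ _ wj yv _ _).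
  by rewrite kwj symk kvy => /(_ c3 erefl) jv; rewrite jv Tv in Ej.
have := old w; rewrite mem_iota /= wT => /(_ isT).
rewrite (tryP _ lab); first last.
- by [].
- by rewrite /join !size_upd.
- by apply: represents_join; rewrite ?Lw.
(* Loops being excluded, the test fails only if [v] and [w] are already joined in the table; that
   edge has color [c], yet the slot of [c] at [v] is unrevealed. *)
rewrite /cand Tw [isUnk _]/=; case: ifP => // /negbFE/orP[]; first by rewrite eqnE (negbTE vw).
case/hasP=> c' c'3; rewrite /isTo; case Ec': (get T v c') => [||w'] //.
rewrite eqnE => /eqP ww'; rewrite -{w'}ww' in Ec'.
have {}c'3 : c' < 3 by move: c'3; rewrite !inE; case/or3P=> /eqP->.
have := ok v c' vT c'3; rewrite /slot_ok Ec' => -[_ _ kc' _].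
by rewrite Lw kvy in kc'; rewrite -kc' Tv in Ec'.
Qed.

End Search.

(** With 16 vertices, four of them of degree 2, there are 22 edges, of which [da] and seven edges of
    [T0] are placed. Each level reveals one more, so fuel 30 is ample. *)
Lemma search_T0 : search 30 16 T0.
Proof. by vm_cast_no_check (erefl true). Qed.

(** * Kempe chains *)

Section Involutions.

Variable T : finType.

(** The pairs formed by [x] and [f x] partition [A]; they are removed one at a time. *)
Lemma odd_fixpoint_free (f : T -> T) (A : {set T}) :
  (forall x, x \in A -> [/\ f x \in A, f x != x & f (f x) = x]) -> ~~ odd #|A|.
Proof.
elim: {A}_.+1 {-2}A (ltnSn #|A|) => // n IH A; rewrite ltnS => An fA.
have [->|/set0Pn[x xA]] := eqVneq A set0; first by rewrite cards0.
have [fxA fx ffx] := fA x xA.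
have fxAx : f x \in A :\ x by rewrite !inE fx.
rewrite (cardsD1 x A) xA (cardsD1 (f x) (A :\ x)) fxAx /= negbK.
apply: IH => [|y].
  by apply: leq_trans An; rewrite (cardsD1 x A) xA (cardsD1 (f x) (A :\ x)) fxAx ltnS leqnSn.
rewrite !inE => /and3P[yfx yx yA]; have [fyA fy ffy] := fA y yA; split=> //.
rewrite fyA andbT; apply/andP; split.
  by apply: contra yx => /eqP e; rewrite -ffy e ffx.
by apply: contra yfx => /eqP <-; rewrite ffy.
Qed.

Variables f g : T -> T.
Hypotheses (fK : involutive f) (gK : involutive g).

Let p x := g (f x).

Let pI : injective p.
Proof. exact: inj_comp (inv_inj gK) (inv_inj fK). Qed.

(** Conjugation by [f] inverts [p]. *)
Let pfp x i : iter i p (f (iter i p x)) = f x.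
Proof. by elim: i x => // i IH x; rewrite iterS iterSr /p -/(p _) !IH /p; rewrite fK gK. Qed.

(** By [pfp], [p^i] maps [f (p^i x)] to [f x = x], so this point lies on the same cycle of [p]. *)
Lemma orbit_involl x y : f x = x -> (f y \in orbit p x) = (y \in orbit p x).
Proof.
move=> fx; have imp z : z \in orbit p x -> f z \in orbit p x.
  rewrite -!fconnect_orbit => /iter_findex <-; set i := findex p x z.
  by have := fconnect_iter p i (f (iter i p x)); rewrite pfp fx (fconnect_sym pI).
by apply/idP/idP => /imp //; rewrite fK.
Qed.

Lemma orbit_involr x y : f x = x -> (g y \in orbit p x) = (y \in orbit p x).
Proof.
move=> fx; rewrite -{1}(fK y) -[g (f (f y))]/(p (f y)) -(orbit_involl y fx).
by rewrite -!fconnect_orbit -(same_fconnect1_r pI).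
Qed.

(* If [z = p^i x] with [0 < i < order p x], then [f z = z] means [2 i = order p x]
   and [g z = z] means [2 i = (order p x).+1]. *)
Lemma orbit_end_unique x y z : f x = x ->
  y \in orbit p x -> z \in orbit p x -> y != x -> z != x ->
  (f y == y) || (g y == y) -> (f z == z) || (g z == z) -> y = z.
Proof.
move=> fx; set n := order p x.
have xn : iter n p x = x by apply: iter_order.
have key t : t \in orbit p x -> t != x -> (f t == t) || (g t == t) ->
    exists2 i, t = iter i p x & i = n.+1./2.
  rewrite -fconnect_orbit => xt tx ends; exists (findex p x t); first by rewrite iter_findex.
  have := findex_max xt; rewrite -/n => lt_in; set i := findex p x t in lt_in *.
  have ti : iter i p x = t by apply: iter_findex.
  have i0 : 0 < i by rewrite lt0n; apply: contraNneq tx => i0; rewrite -ti i0.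
  have pinj j : injective (iter j p).
    by move=> u v; elim: j => //= j IHj /pI.
  have fti : f t = iter (n - i) p x.
    by apply: (pinj i); rewrite -{1}ti pfp fx -iterD subnKC ?xn // ltnW.
  have iter_eq a b : a < n -> b < n -> iter a p x = iter b p x -> a = b.
    move=> an bn e; rewrite -(findex_iter an) -(findex_iter bn) e //.
  case/orP: ends => /eqP e.
    have ni : n - i < n by rewrite ltn_subrL i0 (leq_trans _ lt_in).
    have := iter_eq _ _ ni lt_in; rewrite -fti e ti => /(_ erefl) nii.
    by rewrite -(subnK (ltnW lt_in)) nii addnn -[i.*2.+1]/(true + i.*2) half_bit_double.
  have ni : (n - i).+1 <= n by rewrite ltn_subrL i0 (leq_trans _ lt_in).
  have gt : g t = iter (n - i).+1 p x by rewrite iterS -fti /p fK.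
  (* Exponents determine points only below [n]; exponent [n] itself would make [t] equal to [x]. *)
  have [ni1|ni1] := eqVneq (n - i).+1 n.
    by case/eqP: tx; rewrite -e gt ni1 xn.
  have lt1 : (n - i).+1 < n by rewrite ltn_neqAle ni1.
  have := iter_eq _ _ lt1 lt_in; rewrite -gt e ti => /(_ erefl) nii.
  by rewrite -(subnK (ltnW lt_in)) -addSn nii addnn doubleK.
move=> xy xz yx zx ey ez.
by have [i -> ->] := key y xy yx ey; have [j -> ->] := key z xz zx ez.
Qed.

End Involutions.

(** * Colorings of all edges but one *)

Section NearColorings.

Variable G : sgraph.
Implicit Types (x y z u v : G) (k : G -> G -> nat).

Definition colors_all_but x y k :=
  [/\ pcoloring k, k x y = 3 &
      forall u v, adj u v -> ~~ same_pair u v x y -> k u v < 3].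

Lemma eq_set2 x y u v : ([set x; y] == [set u; v]) = same_pair x y u v.
Proof.
apply/eqP/idP => [e|/orP[]/andP[/eqP-> /eqP->]//]; last by rewrite setUC.
move/setP: e => e; move: (e x) (e y) (e u) (e v); rewrite !inE !eqxx /same_pair.
rewrite [u == x]eq_sym [u == y]eq_sym [v == x]eq_sym [v == y]eq_sym.
by case: (x == u); case: (x == v); case: (y == u); case: (y == v); rewrite ?orbT.
Qed.

Lemma del_edge_coloring x y : edge_colorable (del_edge [set x; y]) 3 ->
  exists k, colors_all_but x y k.
Proof.
case/existsP=> c /forallP c_ok.
pose D := del_edge [set x; y].
(* Pairs that are not edges of the smaller graph, [x y] among them, get the value 3. *)
pose k u v := if insub [set u; v] : option {E : {set D} | E \in edges D} is Some e
              then val (c e) else 3.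
have kE u v (uv : [set u; v] \in edges D) : k u v = c (exist _ [set u; v] uv).
  by rewrite /k (insubT (fun E => E \in edges D) uv).
have edgeP u v : adj u v -> ([set u; v] \in edges D) = ~~ same_pair u v x y.
  move=> uv; rewrite -eq_set2; apply/imsetP/idP => [[p]|ne]; last first.
    by exists (u, v) => //; rewrite inE /= /del_adj uv.
  by rewrite inE /= /del_adj => /andP[_ ne] ->.
have k3 u v : k u v < 3 -> [set u; v] \in edges D.
  by rewrite /k; case: insubP.
exists k; split.
- split=> [u v|u v w uv uw]; first by rewrite /k setUC.
  move=> kuv; have uvD := k3 _ _ kuv => e; have uwD : [set u; w] \in edges D by apply: k3; rewrite -e.
  apply: contraTeq isT => vw; have /forallP/(_ (exist _ [set u; w] uwD)) := c_ok (exist _ [set u; v] uvD).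
  move: e; rewrite (kE _ _ uvD) (kE _ _ uwD) => /val_inj ->; rewrite eqxx implybF negb_and.
  rewrite -val_eqE /= eq_set2 /same_pair eqxx (negbTE vw) /=.
  have -> : (u == w) && (v == u) = false.
    by apply: contraNF vw => /andP[/eqP <- ]. 
  by case/set0Pn; exists u; rewrite !inE eqxx.
- rewrite /k; case: insubP => // e /imsetP[p]; rewrite inE /= /del_adj => /andP[_ ne] ee.
  by rewrite ee eqxx in ne.
- by move=> u v uv; rewrite -edgeP // => uvD; rewrite kE.
Qed.

Definition seen k x c := [exists y, adj x y && (k x y == c)].

Lemma seenP k x c : reflect (exists2 y, adj x y & k x y = c) (seen k x c).
Proof. by apply: (iffP existsP) => [[y /andP[? /eqP]]|[y ? /eqP ?]]; exists y => //; apply/andP. Qed.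

Lemma seenPn k x c : reflect (free k x c) (~~ seen k x c).
Proof.
apply: (iffP idP) => [/existsPn nx y xy e|fr]; first by have := nx y; rewrite xy e eqxx.
by apply/existsPn => y; apply/negP => /andP[/fr k_ne /eqP].
Qed.

Definition palette k x : {set 'I_3} := [set c : 'I_3 | seen k x c].

Lemma card_palette k x : pcoloring k ->
  #|palette k x| = #|[set y | adj x y && (k x y < 3)]|.
Proof.
move=> [symk prk]; rewrite -(card_in_imset (f := fun y => inord (k x y) : 'I_3)); last first.
  move=> y z; rewrite !inE => /andP[xy ky] /andP[xz kz] /(congr1 val) /=.
  by rewrite !inordK //; apply: prk.
apply: eq_card => c; rewrite inE; apply/seenP/imsetP => [[y xy ky]|[y]].
  by exists y; [rewrite inE xy ky ltn_ord | rewrite ky inord_val].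
by rewrite inE => /andP[xy ky] ->; exists y; rewrite // inordK.
Qed.

Lemma palette_full k x : pcoloring k -> (forall y, adj x y -> k x y < 3) ->
  #|palette k x| = degree x.
Proof.
move=> pk all3; rewrite card_palette //; apply: eq_card => y; rewrite !inE.
by case: (boolP (adj x y)) => //= /all3.
Qed.

Lemma colors_all_butC x y k : colors_all_but x y k -> colors_all_but y x k.
Proof.
case=> pk kxy all3; split=> //; first by rewrite pk.1.
by move=> u v uv; rewrite /same_pair orbC; apply: all3.
Qed.

Lemma palette_end k x y : colors_all_but x y k -> adj x y ->
  #|palette k x|.+1 = degree x.
Proof.
move=> [pk kxy all3] xy; rewrite card_palette // /degree [in RHS](cardsD1 y) [y \in _]inE xy add1n; congr _.+1.
apply: eq_card => z; rewrite !inE andbC; case: (eqVneq z y) => [->|zy] /=.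
  by rewrite kxy ?andbF.
case: (boolP (adj x z)) => xz; rewrite ?andbF // andbT all3 //.
by rewrite /same_pair eqxx (negbTE zy) /=; apply/negP => /andP[/eqP xy' _]; rewrite xy' adj_irrefl in xy.
Qed.

Lemma palette_else k x y z : colors_all_but x y k -> z != x -> z != y ->
  #|palette k z| = degree z.
Proof.
move=> [pk kxy all3] zx zy; apply: palette_full => // t zt; apply: all3 => //.
by rewrite /same_pair (negbTE zx) (negbTE zy).
Qed.

Lemma extend_coloring k x y c : colors_all_but x y k ->
  c < 3 -> free k x c -> free k y c -> edge_colorable G 3.
Proof.
move=> [pk kxy all3] c3 fx fy.
apply: (pcoloring_total (k := recolor k x y c)); first by apply: pcoloring_recolor.
by move=> u v uv; rewrite /recolor; case: ifP => // /negbT; apply: all3.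
Qed.

(** A color missing at both ends could be given to the edge [x y]. *)
Lemma palette_cover k x y : ~ edge_colorable G 3 -> colors_all_but x y k ->
  palette k x :|: palette k y = setT.
Proof.
move=> nG kxy; apply/setP => c; rewrite !inE; apply/negPn/negP; rewrite negb_or.
by case/andP=> /seenPn fx /seenPn fy; case: nG; apply: extend_coloring kxy _ fx fy.
Qed.

End NearColorings.

(** * Swapping two colors along Kempe chains *)

Section KempeChains.

Variable G : sgraph.
Implicit Types (x y z u v : G) (k : G -> G -> nat) (A : {set G}).

(** Vertices where [c] is free are fixed, which makes this an involution on all of [G]; fixed points
    mark the ends of chains. *)
Definition partner k c u :=
  if [pick z | adj u z && (k u z == c)] is Some z then z else u.

Variant partner_spec k c u : G -> bool -> Type :=
  | PartnerSeen z of adj u z & k u z = c : partner_spec k c u z true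
  | PartnerFree of free k u c : partner_spec k c u u false.

Lemma partnerP k c u : partner_spec k c u (partner k c u) (seen k u c).
Proof.
rewrite /partner; case: pickP => [z /andP[uz /eqP kuz]|no].
  have -> : seen k u c by apply/seenP; exists z.
  by constructor.
have fr : free k u c by move=> z uz /eqP kuz; have := no z; rewrite uz kuz.
by have /seenPn/negbTE-> := fr; constructor.
Qed.

Lemma partnerE k c u z : pcoloring k -> c < 3 -> adj u z -> k u z = c -> partner k c u = z.
Proof.
move=> [_ prk] c3 uz kuz; case: partnerP => [t ut kut|/(_ z uz)//].
by apply: (prk u) => //; rewrite ?kut // kuz.
Qed.

Lemma partnerK k c : pcoloring k -> c < 3 -> involutive (partner k c).
Proof.
move=> pk c3 u; have [symk _] := pk; case: (partnerP k c u) => [z uz kuz|fu].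
  by apply: partnerE; rewrite // 1?adj_sym // symk.
by case: partnerP => // z /fu.
Qed.

Lemma partner_free k c u : free k u c -> partner k c u = u.
Proof. by move=> fu; case: partnerP => // z /fu. Qed.

(** The edges of color [c] match up the vertices that see [c]. *)
Lemma even_seen k c : pcoloring k -> c < 3 -> ~~ odd #|[set v | seen k v c]|.
Proof.
move=> pk c3; apply: (odd_fixpoint_free (f := partner k c)) => v; rewrite inE => sv.
rewrite partnerK //; move: sv; case: partnerP => // z vz kvz _.
rewrite inE eq_sym adj_neq //; split=> //; apply/seenP; exists v; first by rewrite adj_sym.
by rewrite pk.1.
Qed.

Definition transpose a b c : nat := if c == a then b else if c == b then a else c.

(** Asking for both endpoints keeps this symmetric for every [A]; when [A] is a union of chains, one
    endpoint decides ([swapE]). *)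
Definition swap k a b A : G -> G -> nat :=
  fun x y => if (x \in A) && (y \in A) then transpose a b (k x y) else k x y.

Lemma transposeK a b : involutive (transpose a b).
Proof.
move=> c; rewrite /transpose; case: (eqVneq c a) => [->|ca].
  by rewrite eqxx; case: eqP.
by case: (eqVneq c b) => [->|cb]; rewrite ?eqxx // (negbTE ca) (negbTE cb).
Qed.

Lemma transpose_lt a b c : a < 3 -> b < 3 -> (transpose a b c < 3) = (c < 3).
Proof.
by move=> a3 b3; rewrite /transpose; case: eqP => [->|_]; rewrite ?a3 ?b3 //; case: eqP => [->|_]; rewrite ?a3 ?b3.
Qed.

Section Swap.

Variables (k : G -> G -> nat) (a b : nat) (A : {set G}).
Hypotheses (pk : pcoloring k) (a3 : a < 3) (b3 : b < 3).
Hypothesis closedA :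
  forall x y, adj x y -> (k x y == a) || (k x y == b) -> (x \in A) = (y \in A).

Lemma swapE x y : adj x y ->
  swap k a b A x y = if x \in A then transpose a b (k x y) else k x y.
Proof.
move=> xy; rewrite /swap; case: (boolP (x \in A)) => //= xA.
case: (boolP (y \in A)) => //= yA; rewrite /transpose.
have := closedA xy; rewrite xA (negbTE yA).
by case: eqP => [_ /(_ isT)//|_]; case: eqP => [_ /(_ isT)//|].
Qed.

Lemma pcoloring_swap : pcoloring (swap k a b A).
Proof.
have [symk prk] := pk; split=> [x y|x y z xy xz].
  by rewrite /swap andbC symk.
rewrite !swapE //; case: ifP => _; last exact: prk.
by rewrite transpose_lt // => k3 /(can_inj (transposeK a b)); apply: prk.
Qed.

Lemma free_swap x c :
  free (swap k a b A) x c <-> free k x (if x \in A then transpose a b c else c).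
Proof.
split=> fr y xy; have := fr y xy; rewrite swapE //; case: ifP => // _ ne e; apply: ne.
  by rewrite e transposeK.
by rewrite -e transposeK.
Qed.

Lemma colors_all_but_swap x y : colors_all_but x y k -> colors_all_but x y (swap k a b A).
Proof.
case=> _ kxy all3; split; first exact: pcoloring_swap.
  by rewrite /swap kxy; case: ifP => // _; rewrite /transpose !gtn_eqF.
by move=> u v uv uvxy; rewrite /swap; case: ifP => _; rewrite ?transpose_lt // all3.
Qed.

End Swap.

(** As [a] is free at [y], the chain in colors [a], [b] through [y] ends there, and the orbit is its
    whole vertex set. *)
Lemma closed_orbit k a b y : pcoloring k -> a < 3 -> b < 3 -> free k y a ->
  let A := [set z | z \in orbit (fun x => partner k b (partner k a x)) y] in
  forall u v, adj u v -> (k u v == a) || (k u v == b) -> (u \in A) = (v \in A).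
Proof.
move=> pk a3 b3 fy A u v uv; rewrite !inE => /orP[]/eqP kuv.
  rewrite -(partnerE pk a3 uv kuv) orbit_involl //; last exact: partner_free.
    exact: partnerK.
  exact: partnerK.
rewrite -(partnerE pk b3 uv kuv) orbit_involr //; last exact: partner_free.
  exact: partnerK.
exact: partnerK.
Qed.

End KempeChains.

(** * Structure of critical graphs of even order *)

Section Critical.

Variable G : sgraph.
Implicit Types (x y z u v : G) (k : G -> G -> nat) (A : {set G}).

Hypothesis not_colorable : ~ edge_colorable G 3.
Hypothesis critical : forall x y, adj x y -> exists k, colors_all_but x y k.
Hypothesis degree_le3 : forall x, degree x <= 3.

(** In a coloring of all edges but [x y], the palettes of the two ends have one color less than the
    degrees and together cover all three colors. *)
Lemma degree_sum x y : adj x y -> 5 <= degree x + degree y.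
Proof.
move=> xy; have [k kxy] := critical xy; have yx : adj y x by rewrite adj_sym.
rewrite -(palette_end kxy xy) -(palette_end (colors_all_butC kxy) yx) addSn addnS !ltnS.
apply: leq_trans (leq_of_leqif (leq_card_setU _ _)).
by rewrite (palette_cover not_colorable kxy) cardsT card_ord.
Qed.

(** Palettes of sizes 1 and at most 2 that cover three colors are complementary. *)
Lemma palette_disjoint x y k : colors_all_but x y k -> adj x y -> degree x = 2 ->
  forall c, c < 3 -> seen k x c = ~~ seen k y c.
Proof.
move=> kxy xy dx c c3; have yx : adj y x by rewrite adj_sym.
have ex := palette_end kxy xy; have ey := palette_end (colors_all_butC kxy) yx.
have cov := palette_cover not_colorable kxy.
have := cardsUI (palette k x) (palette k y); rewrite cov cardsT card_ord => e.
have dy := degree_le3 y; rewrite -ey ltnS in dy; rewrite dx in ex; case: ex => ex.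
have I0 : palette k x :&: palette k y == set0.
  by rewrite -cards_eq0 -leqn0 -(leq_add2l 3) e ex addn0.
have := in_setT (Ordinal c3); rewrite -cov !inE /=.
move/setP/(_ (Ordinal c3)): (eqP I0); rewrite !inE /=.
by case: (seen k x c); case: (seen k y c).
Qed.

Lemma third_color a b : a < 3 -> b < 3 -> a != b ->
  exists c, [/\ c < 3, c != a, c != b & forall d, d < 3 -> [|| d == a, d == b | d == c]].
Proof.
by case: a => [|[|[]]] //; case: b => [|[|[]]] // _ _ _;
  [exists 2|exists 1|exists 2|exists 0|exists 1|exists 0]; split=> // -[|[|[]]].
Qed.

(** Suppose they differ, and leave [x y] uncolored. Then [x] sees only a color [a], [y] misses only
    [a], and [y x'] has a color [b] missing at [x]. If [x'] misses [a], then [y x'] takes [a] and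
    [x y] takes [b]. Otherwise [x'] misses the third color [c], and the chain in colors [a], [c]
    from [y] decides. *)
Lemma degree2_separated x x' y : adj y x -> adj y x' -> degree x = 2 -> degree x' = 2 -> x = x'.
Proof.
move=> yx yx' dx dx'; apply/eqP; apply: contraT => xx'; case: not_colorable.
have xy : adj x y by rewrite adj_sym.
have [k kxy] := critical xy; have [pk k3 all3] := kxy; have [symk prk] := pk.
have opp := palette_disjoint kxy xy dx.
have x'x : x' != x by rewrite eq_sym.
have x'y : x' != y by rewrite eq_sym adj_neq.
pose b := k y x'.
have b3 : b < 3.
  by apply: all3 => //; rewrite /same_pair eqxx (negbTE x'x) (negbTE x'y) ?andbF.
have yb : seen k y b by apply/seenP; exists x'.
have xb : ~~ seen k x b by rewrite opp // yb.
have /eqP/cards1P[[a a3] Pa] : #|palette k x| = 1 by apply: succn_inj; rewrite (palette_end kxy xy).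
have xE c : c < 3 -> seen k x c = (c == a).
  by move=> c3; move/setP/(_ (Ordinal c3)): Pa; rewrite !inE.
have ab : a != b by rewrite eq_sym -xE.
have [c [c3 ca cb cov]] := third_color a3 b3 ab.
have ya : free k y a by apply/seenPn; rewrite -opp // xE.
have xc : free k x c by apply/seenPn; rewrite xE.
(* Recoloring [y x'] from [b] to [a] frees [b] at [y], while [b] is free at [x]. *)
have finish k1 : colors_all_but x y k1 -> free k1 y a -> free k1 x' a -> free k1 x b ->
    k1 y x' = b -> edge_colorable G 3.
  move=> kxy1 y1 x'1 xb1 kyx'; have [pk1 k31 all31] := kxy1.
  apply: (@extend_coloring _ (recolor k1 y x' a) x y b) => //.
  - split; first by apply: pcoloring_recolor.
      by rewrite /recolor /same_pair (negbTE (adj_neq xy)) (negbTE xx').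
    by move=> u v uv uvxy; rewrite /recolor; case: ifP => // _; apply: all31.
  - move=> z xz; rewrite /recolor /same_pair (negbTE (adj_neq xy)) (negbTE xx') /=.
    exact: xb1.
  - move=> z yz; rewrite /recolor; case: ifP => [_ e|ne e]; first by rewrite e eqxx in ab.
    have zx' : z = x' by apply: (pk1.2 y) => //; rewrite ?e // kyx'.
    by rewrite zx' /same_pair !eqxx in ne.
have [x'a|x'a] := boolP (seen k x' a); last first.
  by apply: finish kxy ya _ _ _ => //; apply/seenPn.
have x'c : free k x' c.
  apply/seenPn/negP => x'c; have := palette_else kxy x'x x'y; rewrite dx'.
  have -> : palette k x' = setT.
    apply/setP => d; rewrite !inE; case/or3P: (cov d (ltn_ord d)) => /eqP-> //.
    by apply/seenP; exists y; [rewrite adj_sym | rewrite symk].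
  by rewrite cardsT card_ord.
pose f := partner k a; pose g := partner k c.
have fK : involutive f by apply: partnerK.
have gK : involutive g by apply: partnerK.
pose A := [set z | z \in orbit (fun z => g (f z)) y].
have clA := closed_orbit pk a3 c3 ya : forall u v, _ -> _ -> (u \in A) = (v \in A).
have yA : y \in A by rewrite inE -fconnect_orbit connect0.
have [xA|xA] := boolP (x \in A).
  (* Both [x] and [x'] miss [c], but the chain has only one end besides [y]. *)
  have x'A : x' \notin A.
    apply: contra xx' => x'A; apply/eqP; rewrite !inE in xA x'A.
    apply: (orbit_end_unique fK gK _ xA x'A); rewrite /f /g ?adj_neq //.
    - exact: partner_free.
    - by rewrite adj_sym.
    - by rewrite (partner_free xc) eqxx orbT.
    - by rewrite (partner_free x'c) eqxx orbT.
  have clC u v : adj u v -> (k u v == a) || (k u v == c) -> (u \in ~: A) = (v \in ~: A).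
    by move=> uv kuv; rewrite !in_setC (clA u v).
  (* Swapping off the chain frees [a] at [x'] and changes nothing at [x] and [y]. *)
  apply: (finish (swap k a c (~: A))).
  - exact: colors_all_but_swap.
  - by apply/free_swap; rewrite // in_setC yA.
  - by apply/free_swap; rewrite // in_setC x'A /transpose eqxx.
  - by apply/free_swap; rewrite // in_setC xA; apply/seenPn.
  - by rewrite /swap !in_setC yA.
(* Swapping along the chain frees [c] at [y], while [x] lies off it and still misses [c]. *)
apply: (@extend_coloring _ (swap k a c A) x y c) => //.
- exact: colors_all_but_swap.
- by apply/free_swap; rewrite // (negbTE xA).
- by apply/free_swap; rewrite // yA /transpose (negbTE ca) eqxx.
Qed.

Hypothesis has_neighbor : forall x, exists y, adj x y.
Hypothesis even_order : ~~ odd #|G|.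

Let D := [set x : G | degree x == 2].

(** A vertex of degree at most 1 and a neighbor of degree at most 3 would violate [degree_sum]. *)
Lemma degree_critical x : degree x = if x \in D then 2 else 3.
Proof.
rewrite inE; case: eqP => // x2; have [y xy] := has_neighbor x.
apply/eqP; rewrite eqn_leq degree_le3 ltnNge; apply/negP => x2'.
have := degree_sum xy; have := degree_le3 y.
move: x2' (x2); rewrite leq_eqVlt => /orP[/eqP//|]; rewrite ltnS => dx _ dy.
by rewrite leqNgt ltnS (leq_add dx dy).
Qed.

Lemma neighbor_notin_D x y : x \in D -> adj x y -> y \notin D.
Proof.
move=> xD xy; apply/negP => yD; have := degree_sum xy.
by rewrite !degree_critical xD yD.
Qed.

(** Counts the edges leaving [D]: two at each vertex of [D], at most one at each vertex outside, by
    [degree2_separated]. *)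
Lemma card_D : 3 * #|D| <= #|G|.
Proof.
have e : \sum_(x in D) \sum_(y : G) adj x y = 2 * #|D|.
  rewrite mulnC -sum_nat_const; apply: eq_bigr => x; rewrite inE => /eqP <-.
  by rewrite /degree -sum1_card [RHS]big_mkcond; apply: eq_bigr => y _; rewrite inE; case: adj.
have : \sum_(x in D) \sum_(y : G) adj x y <= #|~: D|.
  rewrite exchange_big /= -sum1_card [in X in _ <= X]big_mkcond.
  apply: leq_sum => y _; rewrite in_setC; case: ifP => [yD|/negbFE yD]; last first.
    rewrite big1 // => x xD; apply/eqP; rewrite eqb0; apply/negP => xy.
    by rewrite (negbTE (neighbor_notin_D xD xy)) in yD.
  have [x /andP[xD xy]|no] := pickP (fun x => (x \in D) && adj x y); last first.
    by rewrite big1 // => x xD; have := no x; rewrite xD /= => ->.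
  rewrite (bigD1 x) //= xy big1 // => z /andP[zD zx]; apply/eqP; rewrite eqb0.
  apply: contra zx => zy; apply/eqP; apply: (@degree2_separated z x y).
  - by rewrite adj_sym.
  - by rewrite adj_sym.
  - by rewrite degree_critical zD.
  - by rewrite degree_critical xD.
by rewrite e -(leq_add2l #|D|) cardsC -[#|D| in X in X + _]mul1n -mulnDl.
Qed.

Lemma even_free k c : pcoloring k -> c < 3 -> ~~ odd #|[set v | ~~ seen k v c]|.
Proof.
move=> pk c3; have := even_order; rewrite -(cardsC [set v | seen k v c]) oddD.
rewrite (negbTE (even_seen pk c3)) /=; congr (~~ odd #|pred_of_set _|).
by apply/setP => v; rewrite !inE.
Qed.

Lemma all_seen k v : #|palette k v| = 3 -> forall c, c < 3 -> seen k v c.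
Proof.
move=> p3 c c3; have /eqP pT : palette k v == setT.
  by rewrite eqEcard subsetT cardsT card_ord p3.
by have := in_setT (Ordinal c3); rewrite -pT inE.
Qed.

(** In a cubic [G] with [x y] uncolored, a color missing at [x] would be missing nowhere else,
    against parity. *)
Lemma D_nonempty (x0 : G) : exists d, d \in D.
Proof.
have [D0|/set0Pn//] := eqVneq D set0.
have [x [y xy]] : exists x y : G, adj x y.
  by have [y xy] := has_neighbor x0; exists x0, y.
have d3 z : degree z = 3 by rewrite degree_critical D0 inE.
have [k kxy] := critical xy; have [pk _ _] := kxy.
have /eqP px : #|palette k x| == 2 by rewrite -eqSS (palette_end kxy xy) d3.
have /eqP py : #|palette k y| == 2.
  by rewrite -eqSS (palette_end (colors_all_butC kxy)) ?d3 // adj_sym.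
have [c c3 nc] : exists2 c, c < 3 & ~~ seen k x c.
  case: (pickP (fun c : 'I_3 => ~~ seen k x c)) => [c nc|no]; first by exists c.
  suff : #|palette k x| = 3 by rewrite px.
  have -> : palette k x = setT.
    by apply/setP => c; rewrite !inE; exact: negbFE (no c).
  by rewrite cardsT card_ord.
have := even_free pk c3; suff -> : [set v | ~~ seen k v c] = [set x] by rewrite cards1.
apply/setP => v; rewrite !inE; have [->//|vx] := eqVneq v x; apply/negbTE; rewrite negbK.
have [->|vy] := eqVneq v y; last by apply: all_seen => //; rewrite (palette_else kxy).
apply: contraT => ncy; case: not_colorable.
by apply: (extend_coloring kxy c3); apply/seenPn.
Qed.

Lemma one_free k v c : #|palette k v| = 2 -> c < 3 -> ~~ seen k v c ->
  forall c', c' < 3 -> c' != c -> seen k v c'.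
Proof.
move=> p2 c3 nc c' c'3 cc'; apply: contraT => nc'.
have : palette k v \subset ~: [set Ordinal c3; Ordinal c'3].
  apply/subsetP => e; rewrite !inE => se; apply/negP => /orP[]/eqP ee; rewrite ee /= in se.
    by rewrite se in nc.
  by rewrite se in nc'.
move/subset_leq_card; rewrite p2 cardsCs setCK card_ord cards2.
by rewrite -val_eqE /= eq_sym cc'.
Qed.

(** * The uncolored edge at a vertex of degree 2 *)

Section EndAtDegree2.

Variables (d a b : G) (k : G -> G -> nat).
Hypotheses (card_lt : #|G| < 18) (dD : d \in D) (da : adj d a) (db : adj d b)
           (ab : a != b) (kda : colors_all_but d a k) (kdb : k d b = 2).

Let F c := [set v in D | (v != d) && ~~ seen k v c].

Lemma seen_d c : c < 3 -> seen k d c = (c == 2).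
Proof.
move=> c3; have p1 : #|palette k d| = 1.
  by apply: succn_inj; rewrite (palette_end kda da) degree_critical dD.
have /cards1P[e pe] : #|palette k d| == 1 by rewrite p1.
have pE c' (c'3 : c' < 3) : seen k d c' = (c' == e).
  by move/setP/(_ (Ordinal c'3)): pe; rewrite !inE.
have d2 : seen k d 2 by apply/seenP; exists b.
by move: d2; rewrite pE // => /eqP e2; rewrite pE // -e2.
Qed.

Lemma seen_a c : c < 3 -> seen k a c = (c != 2).
Proof.
move=> c3; rewrite -seen_d // (palette_disjoint kda da) ?negbK //.
by rewrite degree_critical dD.
Qed.

Let aD : a \notin D := neighbor_notin_D dD da.

Lemma palette_D v : v \in D -> v != d -> #|palette k v| = 2.
Proof.
move=> vD vd; rewrite (palette_else kda) // ?degree_critical ?vD //.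
by apply: contraNneq aD => <-.
Qed.

Lemma full_notin_D v c : v \notin D -> v != a -> c < 3 -> seen k v c.
Proof.
move=> vD va; apply: all_seen; rewrite (palette_else kda) ?degree_critical ?(negbTE vD) //.
by apply: contraNneq vD => ->.
Qed.

(** Outside [F c], color [c] is missed by exactly one vertex: [a] for color 2, [d] for the others.
    The total is even. *)
Lemma odd_F c : c < 3 -> odd #|F c|.
Proof.
move=> c3; have [pk _ _] := kda; have := even_free pk c3.
have -> : [set v | ~~ seen k v c] = (if c == 2 then a else d) |: F c.
  apply/setP => v; rewrite !inE -[degree v == 2]/(degree v == 2).
  have [->|vd] := eqVneq v d.
    by rewrite seen_d //= andbF orbF; case: (c == 2); rewrite ?eqxx ?(negbTE (adj_neq da)).
  have [->|va] := eqVneq v a.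
    rewrite seen_a // negbK; case: (c == 2); rewrite ?eqxx //.
    move: aD; rewrite inE => /negbTE -> /=; rewrite orbF.
    by rewrite eq_sym (negbTE (adj_neq da)).
  have -> : (v == (if c == 2 then a else d)) = false.
    by case: (c == 2); apply/negbTE.
  have [vD|vD] := boolP (v \in D); first by move: vD; rewrite inE => ->.
  by rewrite full_notin_D //; move: vD; rewrite inE => /negbTE ->.
rewrite cardsU1; have -> : (if c == 2 then a else d) \notin F c.
  by rewrite in_set; case: (c == 2); rewrite ?eqxx ?andbF // (negbTE aD).
by rewrite /= negbK.
Qed.

(** Each vertex of [D] other than [d] misses one color, so the three sizes add up to at most 4;
    being odd, all are 1. *)
Lemma card_F c : c < 3 -> #|F c| = 1.
Proof.
have sumF : \sum_(c < 3) #|F c| = #|D :\ d|.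
  transitivity (\sum_(c < 3) \sum_(v in D :\ d) ~~ seen k v c).
    apply: eq_bigr => c' _; rewrite -sum1_card big_mkcond [RHS]big_mkcond.
    by apply: eq_bigr => v _; rewrite !inE; case: (v == d); case: (degree v == 2); case: seen.
  rewrite exchange_big /= -sum1_card; apply: eq_bigr => v; rewrite in_setD1 => /andP[vd vD].
  have := cardsC (palette k v); rewrite palette_D // card_ord => /eqP.
  rewrite (eqn_add2l 2 _ 1) => /eqP c1; transitivity #|~: palette k v| => //.
  rewrite -sum1_card [RHS]big_mkcond; apply: eq_bigr => e _; rewrite !inE.
  by case: seen.
have Dle : #|D :\ d| <= 4.
  have D6 : #|D| < 6.
    by rewrite -(ltn_pmul2l (isT : 0 < 3)); apply: leq_ltn_trans card_D card_lt.
  by move: D6; rewrite (cardsD1 d D) dD.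
have o0 := odd_F (isT : 0 < 3); have o1 := odd_F (isT : 1 < 3); have o2 := odd_F (isT : 2 < 3).
move: sumF Dle; rewrite 3!big_ord_recl big_ord0 /= => <-.
move=> le4 c3; move: c c3; apply: color_ind; move: o0 o1 o2 le4;
  case: #|F 0| => [|[|[|[|[|?]]]]] //; case: #|F 1| => [|[|[|[|[|?]]]]] //;
  case: #|F 2| => [|[|[|[|[|?]]]]] //.
Qed.

Lemma only_free c : c < 3 -> exists e, [/\ e \in D, e != d, ~~ seen k e c,
  forall c', c' < 3 -> c' != c -> seen k e c' &
  forall v, v \in D -> v != d -> ~~ seen k v c -> v = e].
Proof.
move=> c3; have /eqP/cards1P[e Fe] := card_F c3; exists e.
have : e \in F c by rewrite Fe set11.
rewrite in_set => /and3P[eD ed ne]; split=> //.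
  by move=> c' c'3; apply: one_free (palette_D eD ed) c3 ne _ c'3.
by move=> v vD vd nv; apply/set1P; rewrite -Fe in_set vD vd.
Qed.

(** Numbering colors from 1 in the names, [di] is the vertex of [D] other than [d] that misses color
    [i], and [xij] is its neighbor along color [j]. *)
Lemma T0_represented : exists lab, represents d k T0 (d :: a :: lab).
Proof.
have [[symk prk] kda3 _] := kda.
have [d1 [d1D d1d d1f d1s d1u]] := only_free (isT : 0 < 3).
have [d2 [d2D d2d d2f d2s d2u]] := only_free (isT : 1 < 3).
have [d3 [d3D d3d d3f d3s d3u]] := only_free (isT : 2 < 3).
have /seenP[x12 a12 k12] := d1s 1 isT isT; have /seenP[x13 a13 k13] := d1s 2 isT isT.
have /seenP[x21 a21 k21] := d2s 0 isT isT; have /seenP[x23 a23 k23] := d2s 2 isT isT.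
have /seenP[x31 a31 k31] := d3s 0 isT isT; have /seenP[x32 a32 k32] := d3s 1 isT isT.
have d12 : d1 != d2 by apply: contraNneq d1f => ->; apply: d2s.
have d13 : d1 != d3 by apply: contraNneq d1f => ->; apply: d3s.
have d23 : d2 != d3 by apply: contraNneq d2f => ->; apply: d3s.
(* A further vertex of [D] would see all three colors. *)
have DE v : v \in D -> v \in [:: d; d1; d2; d3].
  move=> vD; rewrite !inE; have [//|vd] := eqVneq v d; apply: contraT; rewrite /= !negb_or.
  case/and3P=> v1 v2 v3; have := palette_D vD vd.
  have -> : palette k v = setT.
    apply/setP => -[c c3]; rewrite !inE /=; move: c c3; apply: color_ind.
    - by apply: contraR v1 => nv; rewrite (d1u v).
    - by apply: contraR v2 => nv; rewrite (d2u v).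
    - by apply: contraR v3 => nv; rewrite (d3u v).
  by rewrite cardsT card_ord.
have neDN u v y : u \in D -> v \in D -> adj v y -> u != y.
  by move=> uD vD vy; apply: contraTneq uD => ->; apply: neighbor_notin_D vy.
have neND u v y : u \in D -> v \in D -> adj v y -> y != u.
  by move=> uD vD vy; rewrite eq_sym; apply: neDN vD vy.
have neNN u v y z : u \in D -> v \in D -> u != v -> adj u y -> adj v z -> y != z.
  move=> uD vD uv uy vz; apply: contraNneq uv => yz; rewrite -yz in vz; apply/eqP.
  apply: (@degree2_separated u v y); rewrite 1?adj_sym // degree_critical.
    by rewrite uD.
  by rewrite vD.
have neK u y z : k u y != k u z -> y != z by apply: contra => /eqP ->.
have ne1 : x12 != x13 by apply: (neK d1); rewrite k12 k13.
have ne2 : x21 != x23 by apply: (neK d2); rewrite k21 k23.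
have ne3 : x31 != x32 by apply: (neK d3); rewrite k31 k32.
have [dd1 dd2 dd3] : [/\ d != d1, d != d2 & d != d3] by rewrite ![d == _]eq_sym.
exists [:: b; d1; x12; x13; d2; x21; x23; d3; x31; x32].
have full y c : y \notin D -> y != a -> c < 3 -> sees k y c.
  by move=> yD ya c3; apply/seenP; apply: full_notin_D.
have adjC x y : adj x y -> adj y x by rewrite adj_sym.
have kC x y c : k x y = c -> k y x = c by rewrite symk.
have sa c : c < 3 -> c != 2 -> sees k a c by move=> c3 c2; apply/seenP; rewrite seen_a.
have fa : free k a 2 by apply/seenPn; rewrite seen_a.
have fd c : c < 3 -> c != 2 -> free k d c by move=> c3 c2; apply/seenPn; rewrite seen_d.
have nbrD u y : u \in D -> adj u y -> y \notin D by apply: neighbor_notin_D.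
split=> //.
(* Neighbors of vertices of [D] lie outside [D], and those of different vertices of [D] differ by
   [degree2_separated]. *)
- rewrite /= !inE !negb_or ab ne1 ne2 ne3 d12 d13 d23 dd1 dd2 dd3 /=.
  do ![apply/andP; split] => //;
    match goal with
    | H : is_true (adj ?v ?y) |- is_true (_ != ?y) => by apply: (neDN _ v)
    | H : is_true (adj ?v ?y) |- is_true (?y != _) => by apply: (neND _ v)
    | H : is_true (adj ?u ?y), H' : is_true (adj ?v ?z) |- is_true (?y != ?z) =>
        by apply: (neNN u v)
    end.
- move=> y; rewrite !inE !negb_or => ylab c c3; apply: full => //; last first.
    by case/and3P: ylab.
  case/and5P: ylab => /negbTE yd _ _ /negbTE y1 /and5P[_ _ /negbTE y2 _ /and4P[_ /negbTE y3 _ _]].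
  by apply/negP => /DE; rewrite !inE yd y1 y2 y3.
move=> i c i12; move: c; apply: color_ind;
  move: i i12 => [|[|[|[|[|[|[|[|[|[|[|[|i]]]]]]]]]]]] // _.
all: rewrite /slot_ok /=.
all: first
  [ by apply: fd | by apply: sa | by apply/seenPn
  | by split=> //; [apply: adjC | apply: kC]
  | match goal with H : is_true (adj ?v ?y) |- sees _ ?y _ =>
      by apply: full => //; [apply: (nbrD v) | first [by rewrite eq_sym | apply: (neNN v d)]]
    end ].
Qed.

End EndAtDegree2.

End Critical.

Theorem corollary1p2 :
  ~ exists G : sgraph, [/\ three_critical G, ~~ odd #|G| & #|G| < 18].
Proof.
case=> G [[conn maxd chi4 chi3] evenG ltG].
have not_colorable : ~ edge_colorable G 3.
  move=> col; move: chi4; rewrite /chromatic_index; case: ex_minnP => m _ /(_ 3 col) m3 m4.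
  by rewrite m4 in m3.
have critical (x y : G) : adj x y -> exists k, colors_all_but x y k.
  move=> xy; apply: del_edge_coloring.
  have xyE : [set x; y] \in edges G by apply/imsetP; exists (x, y); rewrite ?inE.
  by have := chi3 _ xyE; rewrite /chromatic_index; case: ex_minnP => m col _ <-.
have degree_le3 (x : G) : degree x <= 3 by rewrite -maxd; apply: leq_bigmax.
have [u [v uv]] : exists u v : G, adj u v.
  case: (pickP (fun p : G * G => adj p.1 p.2)) => [[u v] uv|no]; first by exists u, v.
  suff : max_degree G = 0 by rewrite maxd.
  apply/eqP; rewrite -leqn0; apply/bigmax_leqP => x _; rewrite leqn0 cards_eq0.
  by apply/eqP/setP => y; rewrite !inE; apply: (no (x, y)).
have has_neighbor (x : G) : exists y, adj x y.
  (* The first step of a path from [x] to [u] gives a neighbor. *)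
  have [->|xu] := eqVneq x u; first by exists v.
  by have /connectP[[|y p] /= xp e] := conn x u; [rewrite e eqxx in xu | exists y; case/andP: xp].
have [d] := D_nonempty not_colorable critical degree_le3 has_neighbor evenG u.
rewrite inE => dd; have dD : d \in [set x : G | degree x == 2] by rewrite inE.
have /cards2P[a [b [ab N]]] : #|[set y | adj d y]| == 2 by [].
have nbrE x : adj d x = (x \in [set a; b]) by rewrite -N inE.
have [da db] : adj d a /\ adj d b by rewrite !nbrE set21 set22.
have [k0 kda0] := critical d a da; have [pk0 kda03 all0] := kda0.
have kdb0 : k0 d b < 3.
  apply: all0 => //; rewrite /same_pair eqxx (eq_sym b) (negbTE ab) /=.
  by apply/negP => /andP[/eqP e _]; rewrite e adj_irrefl in da.
(* A global renaming of colors gives [d b] the color 2 that [T0] expects. *)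
pose k := swap k0 (k0 d b) 2 setT.
have kda : colors_all_but d a k by apply: colors_all_but_swap => // x y _ _; rewrite !inE.
have kdb : k d b = 2 by rewrite /k /swap !in_setT /transpose eqxx.
have [lab rep] := T0_represented not_colorable critical degree_le3 has_neighbor evenG
  ltG dD da db ab kda kdb.
have [pk kda3 alls] := kda.
(* Order 17 is excluded by parity. *)
have leG : #|G| <= 16 by move: ltG evenG; rewrite ltnS leq_eqVlt => /orP[/eqP->|].
suff : ~~ search 30 16 T0 by rewrite search_T0.
apply: (search_sound leG not_colorable _ pk 30 rep isT _ da kda3).
- by move=> x y /critical[k1 [pk1 _ all1]]; exists k1.
- by rewrite /= take0.
- by move=> x y xy; rewrite leqNgt; apply: contraNT; apply: alls.
Qed.
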